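(* Let $(X_n)_{n=0,\dots,N}$ be a discrete-time Markov process with natural filtration $(\mathcal{F}_n)$, and let $f=(f_n)_{n=0,\dots,N}$ be a family of real-valued functions on the state space with $f_n(X_n)$ integrable for every $n$. Then for all $0\le n\le N$ $$\sum_{m=0}^{n-1} f_m(X_m) + R_n^N f(X_n) = R_0^N f(X_0) + M_n^{N,f},$$ where $M^{N,f}$ is a martingale with $M_0^{N,f}=0$ and, for $1\le n\le N$, $$M_n^{N,f}-M_{n-1}^{N,f} = \sum_{m=n}^{N-1}\big(P_{n,m}f(X_n)-P_{n-1,m}f(X_{n-1})\big).$$
   Context: The transition operator is $P_{m,n}f(x)=\mathbb{E}[f_n(X_n)\mid X_m=x]$ for $m\le n$ (so $P_{n,n}f=f_n$), and $R_n^N f(x)=\sum_{m=n}^{N-1}P_{n,m}f(x)$, with empty sums equal to $0$ (so $R_N^Nf=0$). *)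

(* Defs.v *)
From HB Require Import structures.
From mathcomp Require Import all_boot all_order all_algebra.
From mathcomp Require Import all_classical all_reals all_analysis.

Set Implicit Arguments.
Unset Strict Implicit.
Unset Printing Implicit Defensive.

Import Order.TTheory GRing.Theory Num.Theory.
Import numFieldNormedType.Exports.

Local Open Scope classical_set_scope.
Local Open Scope ring_scope.

(* [cond_exp_version P G Y Z]: the random variable Z is a version of the
   conditional expectation E[Y | G], for a sub-sigma-algebra G given as a set
   of events. *)
Definition cond_exp_version (R : realType) (d : measure_display)
    (Omega : measurableType d) (P : probability Omega R)
    (G : set (set Omega)) (Y Z : Omega -> R) : Prop :=
  [/\ forall B : set R, measurable B -> G (Z @^-1` B),
      P.-integrable setT (EFin \o Z) &
      forall A : set Omega, G A ->
        (\int[P]_(w in A) (Z w)%:E = \int[P]_(w in A) (Y w)%:E)%E].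

(* Processes with time set {0, ..., N} are indexed by nat; only the indices
   n <= N are ever constrained or used. *)

(* F_n = sigma(X_0, ..., X_n). *)
Definition natural_filtration (d d' : measure_display)
    (Omega : measurableType d) (E : measurableType d')
    (X : nat -> Omega -> E) (n : nat) : set (set Omega) :=
  <<s \bigcup_(k in [set k : nat | (k <= n)%N]) g_sigma_algebra_preimage (X k) >>.

(* P(X_n \in A | F_m) = P(X_n \in A | X_m) almost surely, i.e., the two
   conditional probabilities have a common version. *)
Definition is_markov_process (R : realType) (d d' : measure_display)
    (Omega : measurableType d) (E : measurableType d') (P : probability Omega R)
    (N : nat) (X : nat -> Omega -> E) : Prop :=
  forall (m n : nat) (A : set E), (m <= n <= N)%N -> measurable A ->
    exists Z : Omega -> R,
      cond_exp_version P (g_sigma_algebra_preimage (X m)) \1_(X n @^-1` A) Z /\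
      cond_exp_version P (natural_filtration X m) \1_(X n @^-1` A) Z.

Definition is_martingale (R : realType) (d : measure_display)
    (Omega : measurableType d) (P : probability Omega R) (N : nat)
    (F : nat -> set (set Omega)) (M : nat -> Omega -> R) : Prop :=
  [/\ forall n, (n <= N)%N -> forall B : set R, measurable B -> F n (M n @^-1` B),
      forall n, (n <= N)%N -> P.-integrable setT (EFin \o M n) &
      forall m n, (m <= n <= N)%N -> cond_exp_version P (F m) (M n) (M m)].

(* [regression_version P V Y g]: the function g is a version of
   x |-> E[Y | V = x]. *)
Definition regression_version (R : realType) (d d' : measure_display)
    (Omega : measurableType d) (E : measurableType d') (P : probability Omega R)
    (V : Omega -> E) (Y : Omega -> R) (g : E -> R) : Prop :=
  measurable_fun setT g /\
  cond_exp_version P (g_sigma_algebra_preimage V) Y (g \o V).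

(* [Pf m n] is the function P_{m,n} f : x |-> E[f_n(X_n) | X_m = x].  It is only
   determined up to a null set of the law of X_m, so it is characterised as a
   version; the diagonal is normalised to P_{n,n} f = f_n everywhere. *)
Definition is_transition (R : realType) (d d' : measure_display)
    (Omega : measurableType d) (E : measurableType d') (P : probability Omega R)
    (N : nat) (X : nat -> Omega -> E) (f : nat -> E -> R)
    (Pf : nat -> nat -> E -> R) : Prop :=
  (forall m n, (m <= n <= N)%N ->
     regression_version P (X m) (f n \o X n) (Pf m n)) /\
  (forall n, (n <= N)%N -> Pf n n = f n).

(* R_n^N f, for f given through the functions [Pf m n] = P_{m,n} f. *)
Definition Rsum (R : realType) (E : Type) (Pf : nat -> nat -> E -> R)
    (N n : nat) (x : E) : R :=
  \sum_(n <= m < N) Pf n m x.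

(* Main.v *)
(** Put [Z n m := f m (X m)] for [m < n] and [Z n m := Pf n m (X n)] for
    [m >= n]. Each [Z n m] is a version of E[f m (X m) | F_n]: for [m >= n] this
    is the Markov property for integrable functions of [X m], which follows from
    its definition on indicators by L1 density of simple functions and L1
    contraction of conditional expectation. Hence
    [M n := \sum_(m < N) (Z n m - Pf 0 m (X 0))] is a version of the conditional
    expectation given F_n of one variable that does not depend on [n], and M is
    a martingale by the tower property. *)

Require Import Defs.
From HB Require Import structures.
From mathcomp Require Import all_boot all_order all_algebra.
From mathcomp Require Import all_classical all_reals all_analysis.
From mathcomp Require Import measurable_realfun.

Set Implicit Arguments.
Unset Strict Implicit.
Unset Printing Implicit Defensive.

Import Order.TTheory GRing.Theory Num.Theory.
Import numFieldNormedType.Exports.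
Import HBSimple.

Local Open Scope classical_set_scope.
Local Open Scope ring_scope.

(** * Versions of conditional expectations: linearity, tower property, L1 contraction and L1
    limits *)

Section conditional_expectation.
Context (R : realType) (d : measure_display) (Omega : measurableType d).
Variable P : probability Omega R.
Implicit Types (G H : set (set Omega)) (Y Z : Omega -> R).

(** Links the preimage condition in [cond_exp_version] to measurability on [g_sigma_algebraType G],
    where the closure rules for sums and products are available. *)
Lemma sigma_algebra_measurable_funP G Z : sigma_algebra setT G ->
  (forall B : set R, measurable B -> G (Z @^-1` B)) <->
  measurable_fun setT (Z : g_sigma_algebraType G -> R).
Proof.
move=> sG; split=> [GZ _ B mB|mZ B mB].
  by rewrite setTI; apply: sub_sigma_algebra; exact: GZ.
have := mZ measurableT B mB; rewrite setTI.
by rewrite /measurable/= sigma_algebra_id.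
Qed.

Lemma cond_exp_version_self G Y :
  (forall B : set R, measurable B -> G (Y @^-1` B)) ->
  P.-integrable setT (EFin \o Y) -> cond_exp_version P G Y Y.
Proof. by []. Qed.

Lemma cond_exp_version0 G : sigma_algebra setT G ->
  cond_exp_version P G (fun=> 0) (fun=> 0).
Proof.
move=> sG; apply: cond_exp_version_self; last exact: integrable0.
by apply/sigma_algebra_measurable_funP => //; exact: measurable_cst.
Qed.

Lemma cond_exp_version_tower G H Y Y1 Y2 : G `<=` H ->
  cond_exp_version P G Y Y1 -> cond_exp_version P H Y Y2 ->
  cond_exp_version P G Y2 Y1.
Proof.
move=> GH [GY1 iY1 eY1] [_ _ eY2]; split=> // A GA.
by rewrite eY1// eY2//; exact: GH.
Qed.

Lemma integrable_linear (a : R) Y1 Y2 A : measurable A ->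
  P.-integrable A (EFin \o Y1) -> P.-integrable A (EFin \o Y2) ->
  P.-integrable A (EFin \o (fun w => a * Y1 w + Y2 w)).
Proof.
move=> mA iY1 iY2; rewrite /comp; under eq_fun do rewrite EFinD EFinM.
by apply: integrableD => //; exact: integrableZl.
Qed.

Lemma integral_linear (a : R) Y1 Y2 A : measurable A ->
  P.-integrable A (EFin \o Y1) -> P.-integrable A (EFin \o Y2) ->
  (\int[P]_(w in A) (a * Y1 w + Y2 w)%:E =
   a%:E * \int[P]_(w in A) (Y1 w)%:E + \int[P]_(w in A) (Y2 w)%:E)%E.
Proof.
move=> mA iY1 iY2; under eq_integral do rewrite EFinD EFinM.
by rewrite integralD// ?integralZl//; exact: integrableZl.
Qed.

Lemma cond_exp_version_linear G (a : R) Y1 Y2 Z1 Z2 :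
  sigma_algebra setT G -> G `<=` measurable ->
  P.-integrable setT (EFin \o Y1) -> P.-integrable setT (EFin \o Y2) ->
  cond_exp_version P G Y1 Z1 -> cond_exp_version P G Y2 Z2 ->
  cond_exp_version P G (fun w => a * Y1 w + Y2 w) (fun w => a * Z1 w + Z2 w).
Proof.
move=> sG Gm iY1 iY2 [GZ1 iZ1 eZ1] [GZ2 iZ2 eZ2]; split.
- apply/sigma_algebra_measurable_funP => //.
  apply: measurable_funD; last exact/sigma_algebra_measurable_funP.
  by apply: measurable_funM; [exact: measurable_cst|
    exact/sigma_algebra_measurable_funP].
- exact: integrable_linear.
- move=> A GA; have mA := Gm _ GA.
  have iA Y : P.-integrable setT (EFin \o Y) -> P.-integrable A (EFin \o Y).
    by apply: integrableS.
  by rewrite !integral_linear ?eZ1 ?eZ2//; exact: iA.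
Qed.

Lemma cond_exp_versionB G Y1 Y2 Z1 Z2 :
  sigma_algebra setT G -> G `<=` measurable ->
  P.-integrable setT (EFin \o Y1) -> P.-integrable setT (EFin \o Y2) ->
  cond_exp_version P G Y1 Z1 -> cond_exp_version P G Y2 Z2 ->
  cond_exp_version P G (fun w => Y1 w - Y2 w) (fun w => Z1 w - Z2 w).
Proof.
move=> sG Gm iY1 iY2 c1 c2.
have := cond_exp_version_linear (-1) sG Gm iY2 iY1 c2 c1.
by congr cond_exp_version; apply/funext => w; rewrite mulN1r addrC.
Qed.

Lemma cond_exp_version_sum (I : eqType) (s : seq I) G (Y Z : I -> Omega -> R) :
  sigma_algebra setT G -> G `<=` measurable ->
  (forall i, i \in s -> P.-integrable setT (EFin \o Y i)) ->
  (forall i, i \in s -> cond_exp_version P G (Y i) (Z i)) ->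
  cond_exp_version P G (fun w => \sum_(i <- s) Y i w)
                       (fun w => \sum_(i <- s) Z i w).
Proof.
move=> sG Gm iY cYZ.
(* The induction also carries integrability of the partial sum, which linearity requires at each
   step. *)
suff [] : P.-integrable setT (EFin \o (fun w => \sum_(i <- s) Y i w)) /\
  cond_exp_version P G (fun w => \sum_(i <- s) Y i w)
                       (fun w => \sum_(i <- s) Z i w) by [].
elim: s iY cYZ => [|i s ih] iY cYZ.
  rewrite /comp; under eq_fun do rewrite big_nil.
  under [X in cond_exp_version _ _ X]eq_fun do rewrite big_nil.
  under [X in cond_exp_version _ _ _ X]eq_fun do rewrite big_nil.
  by split; [exact: integrable0|exact: cond_exp_version0].
have [||iS cS] := ih; try by move=> j js; (apply: iY || apply: cYZ);
  rewrite inE js orbT.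
have iYi := iY i (mem_head _ _); have cYi := cYZ i (mem_head _ _).
have cons_sum (V : I -> Omega -> R) : (fun w => \sum_(j <- i :: s) V j w) =
    (fun w => 1 * V i w + \sum_(j <- s) V j w).
  by apply/funext => w; rewrite big_cons mul1r.
rewrite !cons_sum; split; first exact: integrable_linear.
exact: cond_exp_version_linear.
Qed.

(** The sign of [Z] splits the space into two events of [G]. On each of them the integral of [|Z|]
    is, up to sign, that of [Z], hence that of [Y], which is at most the integral of [|Y|]. *)
Lemma cond_exp_version_contraction G Y Z :
  sigma_algebra setT G -> G `<=` measurable ->
  P.-integrable setT (EFin \o Y) -> cond_exp_version P G Y Z ->
  (\int[P]_w `|(Z w)%:E| <= \int[P]_w `|(Y w)%:E|)%E.
Proof.
move=> sG Gm iY [GZ iZ eZ].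
pose A := Z @^-1` [set x | 0 <= x].
have GA : G A by apply: GZ; rewrite -set_itvcy; exact: measurable_itv.
have GAC : G (~` A) by rewrite -setTD; case: sG => _ + _; exact.
have mA := Gm _ GA; have mAC := Gm _ GAC.
have mZ : measurable_fun setT (EFin \o Z) by case/integrableP: iZ.
have mY : measurable_fun setT (EFin \o Y) by case/integrableP: iY.
have split_abs V : measurable_fun setT (EFin \o V) ->
    (\int[P]_w `|(V w)%:E| =
     \int[P]_(w in A) `|(V w)%:E| + \int[P]_(w in ~` A) `|(V w)%:E|)%E.
  move=> mV; rewrite -(setUv A) ge0_integral_setU//.
    by apply: measurableT_comp => //; exact: measurable_funTS.
  by rewrite disj_set2E setICr.
rewrite !split_abs//; apply: leeD.
- under eq_integral.
    move=> w; rewrite inE /A/= => Zw; rewrite ger0_norm//; over.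
  rewrite eZ//; apply: le_trans (le_abse_integral P mA _).
    exact: lee_abs.
  exact: measurable_funTS.
- have -> : (\int[P]_(w in ~` A) `|(Z w)%:E| =
             `|\int[P]_(w in ~` A) (Z w)%:E|)%E.
    rewrite -abseN -integralN//=; last first.
      by apply: integrable_add_def => //; exact: (integrableS measurableT).
    rewrite gee0_abs.
      apply: eq_integral => w; rewrite inE /A/= => /negP.
      by rewrite -ltNge => Zw; rewrite ltr0_norm.
    apply: integral_ge0 => w; rewrite /A/= => /negP.
    by rewrite -ltNge lee_fin oppr_ge0 => /ltW.
  rewrite eZ//; apply: (le_abse_integral P mAC).
  exact: measurable_funTS.
Qed.

Lemma le_abse_integral_setT A Y : measurable A ->
  P.-integrable setT (EFin \o Y) ->
  (`|\int[P]_(w in A) (Y w)%:E| <= \int[P]_w `|(Y w)%:E|)%E.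
Proof.
move=> mA /integrableP[mY _].
apply: (le_trans (le_abse_integral P mA _)); first exact: measurable_funTS.
by apply: ge0_subset_integral => //; exact: measurableT_comp.
Qed.

(* [Y] can be approximated in L1 by variables [V] whose conditional expectations
   given [G] and [H] have a common version [U]. As conditional expectation
   contracts the L1 norm, both [Y] and [Z] integrate over an event of [H] like
   [V] and [U] up to [e], and these two integrals agree. *)
Lemma cond_exp_version_L1_approx G H Y Z :
  sigma_algebra setT G -> G `<=` H -> H `<=` measurable ->
  P.-integrable setT (EFin \o Y) -> cond_exp_version P G Y Z ->
  (forall e : R, 0 < e -> exists V U, [/\ P.-integrable setT (EFin \o V),
    (\int[P]_w `|(Y w - V w)%:E| < e%:E)%E,
    cond_exp_version P G V U & cond_exp_version P H V U]) ->
  cond_exp_version P H Y Z.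
Proof.
move=> sG GH Hm iY cYZ approx; have [GZ iZ eZ] := cYZ.
have Gm : G `<=` measurable by exact: subset_trans Hm.
split=> // [B mB|A HA]; first exact/GH/GZ.
have mA := Hm _ HA.
have iA W : P.-integrable setT (EFin \o W) ->
    (\int[P]_(w in A) (W w)%:E)%E \is a fin_num.
  by move=> iW; apply: integrable_fin_num => //; exact: (integrableS measurableT).
rewrite -[LHS]fineK ?iA// -[RHS]fineK ?iA//; congr EFin.
apply/eqP; rewrite -subr_eq0 -normr_le0; apply/ler_addgt0Pl => e e0.
rewrite addr0.
have [|V [U [iV YV cG cH]]] := approx (e / 2); first exact: divr_gt0.
have [HU iU eU] := cH.
have iB W1 W2 : P.-integrable setT (EFin \o W1) ->
    P.-integrable setT (EFin \o W2) ->
    P.-integrable setT (EFin \o (fun w => W1 w - W2 w)).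
  by move=> i1 i2; rewrite /comp; under eq_fun do rewrite EFinB; exact: integrableB.
(* Contraction is used over [G], where [Z] is already known to be a version for [Y]. The resulting
   L1 bound no longer refers to a sigma-algebra, so it applies on events of [H]. *)
have ZU : (\int[P]_w `|(Z w - U w)%:E| <= \int[P]_w `|(Y w - V w)%:E|)%E.
  apply: (cond_exp_version_contraction sG Gm); first exact: iB.
  exact: cond_exp_versionB.
have dist W1 W2 : P.-integrable setT (EFin \o W1) ->
    P.-integrable setT (EFin \o W2) ->
    (\int[P]_w `|(W1 w - W2 w)%:E| < (e / 2)%:E)%E ->
    `|fine (\int[P]_(w in A) (W1 w)%:E)%E -
      fine (\int[P]_(w in A) (W2 w)%:E)%E| <= e / 2.
  move=> i1 i2 lt12; rewrite -lee_fin -abse_EFin EFinB !fineK ?iA//.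
  rewrite -integralB_EFin//; try exact: (integrableS measurableT).
  apply/ltW/(le_lt_trans _ lt12).
  under eq_integral do rewrite -EFinB.
  by apply: le_abse_integral_setT => //; exact: iB.
have hZ := dist _ _ iZ iU (le_lt_trans ZU YV).
have hY := dist _ _ iY iV YV.
rewrite (eU _ HA) in hZ.
rewrite [leRHS]splitr; apply: le_trans (lerD hZ hY).
by rewrite (distrC (fine (\int[P]_(w in A) (Y w)%:E)%E)) ler_distD.
Qed.

End conditional_expectation.

(** * The Markov property, from indicators to integrable functions of the state *)

Section markov_process.
Context (R : realType) (d d' : measure_display).
Context (Omega : measurableType d) (E : measurableType d').
Variables (P : probability Omega R) (X : nat -> Omega -> E).

Lemma natural_filtration_sigma_algebra n :
  sigma_algebra setT (natural_filtration X n).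
Proof. exact: smallest_sigma_algebra. Qed.

Lemma g_sigma_algebra_preimage_sigma_algebra n :
  sigma_algebra setT (g_sigma_algebra_preimage (X n)).
Proof. by apply: sigma_algebra_preimage; exact: sigma_algebra_measurable. Qed.

Lemma sub_natural_filtration k n : (k <= n)%N ->
  g_sigma_algebra_preimage (X k) `<=` natural_filtration X n.
Proof. by move=> kn A kA; apply: sub_sigma_algebra; exists k. Qed.

Lemma natural_filtration_nondecreasing m n : (m <= n)%N ->
  natural_filtration X m `<=` natural_filtration X n.
Proof.
move=> mn; apply: sub_sigma_algebra2; apply: bigcup_subset => k /= km.
exact: leq_trans mn.
Qed.

Lemma g_sigma_algebra_preimage_measurable n : measurable_fun setT (X n) ->
  g_sigma_algebra_preimage (X n) `<=` measurable.
Proof. by move=> mX _ [B mB <-]; exact: mX. Qed.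

Lemma natural_filtration_measurable n :
  (forall k, (k <= n)%N -> measurable_fun setT (X k)) ->
  natural_filtration X n `<=` measurable.
Proof.
move=> mX; apply: smallest_sub; first exact: sigma_algebra_measurable.
apply: bigcup_sub => k /= kn; apply: g_sigma_algebra_preimage_measurable.
exact: mX.
Qed.

Lemma g_sigma_algebra_preimage_comp n (g : E -> R) : measurable_fun setT g ->
  forall B : set R, measurable B ->
  g_sigma_algebra_preimage (X n) ((g \o X n) @^-1` B).
Proof.
move=> mg B mB; exists (g @^-1` B); last by rewrite setTI.
by rewrite -(setTI (g @^-1` B)); exact: mg.
Qed.

Variable N : nat.
Hypothesis mX : forall n, (n <= N)%N -> measurable_fun setT (X n).
Hypothesis markovX : is_markov_process P N X.

Let filtration_measurable n : (n <= N)%N ->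
  natural_filtration X n `<=` measurable.
Proof.
by move=> nN; apply: natural_filtration_measurable => k kn;
  apply: mX; exact: leq_trans nN.
Qed.

(** A simple function is a finite combination of indicators of its level sets, and the same
    combination of their common versions serves both sigma-algebras. *)
Lemma markov_sfun m n (g : {sfun E >-> R}) : (m <= n <= N)%N ->
  exists Z, cond_exp_version P (g_sigma_algebra_preimage (X m)) (g \o X n) Z /\
            cond_exp_version P (natural_filtration X m) (g \o X n) Z.
Proof.
move=> mnN; have /andP[mn nN] := mnN; have mN := leq_trans mn nN.
pose s : seq R := finmap.enum_fset (fset_set (range g)); pose A i := g @^-1` [set s`_i].
have mA i : measurable (A i) by exact: measurable_funPTI.
have /choice[Z ZE] := fun i => markovX mnN (mA i).
(* The summand [0] gives each term the form [a * Y1 + Y2] of [cond_exp_version_linear]. *)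
have gE : g \o X n =
    (fun w => \sum_(i < size s) (s`_i * \1_(X n @^-1` A i) w + 0)).
  apply/funext => w /=; rewrite fimfunEord; apply: eq_bigr => i _.
  by rewrite addr0.
exists (fun w => \sum_(i < size s) (s`_i * Z i w + 0)); rewrite gE.
have i1 i : P.-integrable setT (EFin \o (\1_(X n @^-1` A i) : Omega -> R)).
  apply: integrable_indic; rewrite -(setTI (X n @^-1` _)).
  exact: mX.
have i0 : P.-integrable setT (EFin \o (fun=> 0 : R) : Omega -> \bar R).
  exact: integrable0.
have sum_version G : sigma_algebra setT G -> G `<=` measurable ->
    (forall i, cond_exp_version P G \1_(X n @^-1` A i) (Z i)) ->
    cond_exp_version P G
      (fun w => \sum_(i < size s) (s`_i * \1_(X n @^-1` A i) w + 0))
      (fun w => \sum_(i < size s) (s`_i * Z i w + 0)).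
  move=> sG Gm cZ; apply: (@cond_exp_version_sum _ _ _ _ _ _ _
    (fun (i : 'I_(size s)) w => s`_i * \1_(X n @^-1` A i) w + 0)
    (fun (i : 'I_(size s)) w => s`_i * Z i w + 0)) => // i _.
    exact: integrable_linear.
  apply: (cond_exp_version_linear s`_i sG Gm (i1 i) i0 (cZ i)).
  exact: cond_exp_version0.
split; apply: sum_version.
- exact: g_sigma_algebra_preimage_sigma_algebra.
- by apply: g_sigma_algebra_preimage_measurable; exact: mX.
- by move=> i; case: (ZE i).
- exact: natural_filtration_sigma_algebra.
- exact: filtration_measurable.
- by move=> i; case: (ZE i).
Qed.

(** The approximation takes place on the state space, in L1 of the law of [X n], so that the
    approximants are still functions of [X n] and [markov_sfun] applies to them. *)
Lemma markov_integrable m n (g : E -> R) Z : (m <= n <= N)%N ->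
  measurable_fun setT g -> P.-integrable setT (EFin \o (g \o X n)) ->
  cond_exp_version P (g_sigma_algebra_preimage (X m)) (g \o X n) Z ->
  cond_exp_version P (natural_filtration X m) (g \o X n) Z.
Proof.
move=> mnN mg ig cZ; have /andP[mn nN] := mnN; have mN := leq_trans mn nN.
have mXn := mX nN.
have mEg : measurable_fun setT (EFin \o g) by exact: measurableT_comp.
have ipg : (pushforward P (X n)).-integrable setT (EFin \o g).
  exact: integrable_pushforward.
apply: (@cond_exp_version_L1_approx _ _ _ _
  (g_sigma_algebra_preimage (X m))) => //.
- exact: g_sigma_algebra_preimage_sigma_algebra.
- exact: sub_natural_filtration.
- exact: filtration_measurable.
move=> e e0.
have [g_ [ig_ _ cvg_g]] := approximation_sfun_integrable measurableT ipg.
have [k gk] : exists k,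
    (\int[pushforward P (X n)]_x `|(g x)%:E - (g_ k x)%:E| < e%:E)%E.
  have [|k _ gk] := cvg_g [set y | (y < e%:E)%E].
    apply: open_nbhs_nbhs; split; first exact: open_ereal_lt_ereal.
    by rewrite /= lte_fin.
  by exists k; exact: (gk k (leqnn k)).
have [U [cG cH]] := markov_sfun (g_ k) mnN.
have mgk : measurable_fun setT (EFin \o g_ k).
  by apply: measurableT_comp => //; exact: measurable_funPT.
exists (g_ k \o X n), U; split=> //.
  have /integrableP[_] := ig_ k; rewrite ge0_integral_pushforward//; last first.
    exact: measurableT_comp.
  by move=> fin_gk; apply/integrableP; split=> //; exact: (measurableT_comp mgk mXn).
move: gk; rewrite ge0_integral_pushforward//.
apply: measurableT_comp => //; under eq_fun do rewrite -EFinB.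
by apply: measurableT_comp => //; exact: measurable_funB.
Qed.

End markov_process.

(** * The decomposition and its martingale *)

Theorem mainTheorem3 (R : realType) (d d' : measure_display)
    (Omega : measurableType d) (E : measurableType d') (P : probability Omega R)
    (N : nat) (X : nat -> Omega -> E) (f : nat -> E -> R)
    (Pf : nat -> nat -> E -> R)
    (mX : forall n, (n <= N)%N -> measurable_fun setT (X n))
    (markovX : is_markov_process P N X)
    (mf : forall n, (n <= N)%N -> measurable_fun setT (f n))
    (intf : forall n, (n <= N)%N -> P.-integrable setT (EFin \o (f n \o X n)))
    (PfE : is_transition P N X f Pf) :
  exists M : nat -> Omega -> R,
    [/\ is_martingale P N (natural_filtration X) M,
        forall w, M 0%N w = 0,
        forall n w, (1 <= n <= N)%N ->
          M n w - M n.-1 w =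
          \sum_(n <= m < N) (Pf n m (X n w) - Pf n.-1 m (X n.-1 w)) &
        forall n w, (n <= N)%N ->
          \sum_(0 <= m < n) f m (X m w) + Rsum Pf N n (X n w) =
          Rsum Pf N 0 (X 0%N w) + M n w].
Proof.
have [regr PfD] := PfE.
have cPf m n : (m <= n <= N)%N ->
    cond_exp_version P (g_sigma_algebra_preimage (X m)) (f n \o X n) (Pf m n \o X m).
  by move=> /regr[].
have iPf m n : (m <= n <= N)%N -> P.-integrable setT (EFin \o (Pf m n \o X m)).
  by move=> /cPf[].
have mPf m n : (m <= n <= N)%N -> measurable_fun setT (Pf m n) by move=> /regr[].
pose Z n m w := if (m < n)%N then f m (X m w) else Pf n m (X n w).
have adapted k n g : (k <= n)%N -> measurable_fun setT g ->
    forall B : set R, measurable B -> natural_filtration X n ((g \o X k) @^-1` B).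
  by move=> kn mg B mB; apply: (sub_natural_filtration kn);
    exact: g_sigma_algebra_preimage_comp.
have cZ n m : (n <= N)%N -> (m < N)%N ->
    cond_exp_version P (natural_filtration X n) (f m \o X m) (Z n m).
  move=> nN /ltnW mN; rewrite /Z; case: ltnP => mn.
    apply: cond_exp_version_self; last exact: intf.
    by apply: adapted; [exact: ltnW|exact: mf].
  have nmN : (n <= m <= N)%N by rewrite mn.
  apply: (markov_integrable mX markovX nmN); [exact: mf|exact: intf|exact: cPf].
(* [Y] equals [M N], because [Z N m] is [f m (X m)] for all [m < N]: the martingale is closed by its
   terminal value. *)
pose Y w := \sum_(0 <= m < N) (f m (X m w) - Pf 0 m (X 0%N w)).
pose M n w := \sum_(0 <= m < N) (Z n m w - Pf 0 m (X 0%N w)).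
have filtration_measurable n : (n <= N)%N -> natural_filtration X n `<=` measurable.
  by move=> nN; apply: natural_filtration_measurable => k kn;
    apply: mX; exact: leq_trans nN.
have cM n : (n <= N)%N -> cond_exp_version P (natural_filtration X n) Y (M n).
  move=> nN; have sF := natural_filtration_sigma_algebra X n.
  have Fm := filtration_measurable _ nN.
  apply: (@cond_exp_version_sum _ _ _ _ _ _ _
    (fun m w => f m (X m w) - Pf 0 m (X 0%N w))
    (fun m w => Z n m w - Pf 0 m (X 0%N w))) => // m;
    rewrite mem_index_iota => /= mN.
    rewrite /comp; under eq_fun do rewrite EFinB.
    apply: integrableB => //; first exact/intf/ltnW.
    by apply: iPf; rewrite /= ltnW.
  apply: cond_exp_versionB => //; first exact/intf/ltnW.
  - by apply: iPf; rewrite /= ltnW.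
  - exact: cZ.
  - apply: cond_exp_version_self; last by apply: iPf; rewrite /= ltnW.
    by apply: adapted => //; apply: mPf; rewrite /= ltnW.
exists M; split.
- split=> [n /cM[]//|n /cM[]//|m n /andP[mn nN]].
  have mN := leq_trans mn nN.
  (* [M m] and [M n] are versions for the same [Y], given the earlier and the later
     sigma-algebra. *)
  apply: cond_exp_version_tower (cM _ mN) (cM _ nN).
  exact: natural_filtration_nondecreasing.
(* At time 0 no [m] lies below [n], so every summand vanishes pointwise, not just almost surely. *)
- by move=> w; rewrite /M; apply: big1 => m _; rewrite /Z/= subrr.
- case=> // n w /= nN.
  (* The increment from [n] to [n.+1] is split at [m = n.+1]: from there on both [Z] terms are
     transition terms and the time 0 terms cancel. *)
  rewrite /M -sumrB (big_cat_nat _ nN)//= [X in X + _ = _]big1_seq ?add0r.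
    apply: eq_big_nat => m /andP[nm _]; rewrite /Z (ltnNge m n.+1) nm (ltnNge m n) (ltnW nm) /=.
    by rewrite opprB addrA subrK.
  (* For [m < n] both [Z] terms are [f m (X m)]. At [m = n] the earlier one is [Pf n n (X n)], and
     the normalised diagonal makes the difference zero everywhere. *)
  move=> m; rewrite mem_index_iota /= ltnS /Z => mn; rewrite ltnS mn.
  case: ltngtP mn => // [mn|->] _; first by rewrite subrr.
  by rewrite PfD ?subrr// ltnW.
(* Adding [Rsum Pf N 0 (X 0)] cancels the time 0 terms of [M n]; what remains is the sum of the
   [Z n m], split at [m = n]. *)
- move=> n w nN; rewrite /M /Rsum sumrB [RHS]addrC subrK.
  rewrite [RHS](big_cat_nat _ nN)//=; congr (_ + _).
    by apply: eq_big_nat => m /andP[_ mn]; rewrite /Z mn.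
  by apply: eq_big_nat => m /andP[nm _]; rewrite /Z ltnNge nm.
Qed.
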